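(* Let $N=1$, let $u_0\in L^1(\mathbb{R})$ be nonnegative and nontrivial, $u$ the mild solution, $M=\int u_0$, and $p\in[1,\infty]$. (a) For every $\mu>0$, $\|t^{\frac\alpha2}u(\cdot,t)-MF(0)\|_{L^p(B_\mu)}\to0$ as $t\to\infty$. (b) For every $g:(0,\infty)\to(0,\infty)$ with $g(t)\to\infty$ and $g(t)/t^{\alpha/2}\to0$ as $t\to\infty$, $(g(t))^{-\frac1p}\|t^{\frac\alpha2}u(\cdot,t)-MF(0)\|_{L^p(B_{g(t)})}\to0$ as $t\to\infty$.
   Context: Fix $N\ge1$ and $\alpha\in(0,1)$. Let $\mathbb{E}_\alpha(s)=\sum_{k\ge0}s^k/\Gamma(1+k\alpha)$ be the Mittag-Leffler function. The fundamental solution of the time-fractional heat equation $\partial_t^\alpha u=\Delta u$ (where $\partial_t^\alpha$ is the Caputo derivative $\partial_t^\alpha u(x,t)=\frac{1}{\Gamma(1-\alpha)}\partial_t\int_0^t\frac{u(x,\tau)-u(x,0)}{(t-\tau)^\alpha}\,d\tau$) is the function $Z$ on $\mathbb{R}^N\times(0,\infty)$ whose Fourier transform in $x$ is $\widehat Z(\omega,t)=\mathbb{E}_\alpha(-|\omega|^2t^\alpha)$. It has the self-similar form $Z(x,t)=t^{-\alpha N/2}F(xt^{-\alpha/2})$ with a positive radially symmetric profile $F$, smooth on $\mathbb{R}^N\setminus\{0\}$, $\int F=1$; when $N=1$, $F$ is bounded and continuous on $\mathbb{R}$. For nonnegative nontrivial $u_0\in L^1(\mathbb{R}^N)$ the (mild)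 solution of $\partial_t^\alpha u=\Delta u$ in $\mathbb{R}^N\times(0,\infty)$, $u(\cdot,0)=u_0$, is $u(x,t)=\int_{\mathbb{R}^N}Z(x-y,t)u_0(y)\,dy$. $B_r=(-r,r)$. *)

(* Defs.v *)
From HB Require Import structures.
From mathcomp Require Import all_boot all_order all_algebra.
From mathcomp Require Import all_classical all_reals all_analysis.
Set Implicit Arguments. Unset Strict Implicit. Unset Printing Implicit Defensive.
Import Order.TTheory GRing.Theory Num.Theory.
Import numFieldNormedType.Exports.
Local Open Scope classical_set_scope.
Local Open Scope ring_scope.
Local Open Scope ereal_scope.
Local Close Scope ereal_scope.

Section Defs.
Context {R : realType}.
Local Notation leb := (@lebesgue_measure R).

Definition Gamma (s : R) : R :=
  Rintegral leb `]0, +oo[ (fun x => x `^ (s - 1) * expR (- x)).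

Definition mittag_leffler (alpha s : R) : R :=
  limn (series (fun k : nat => s ^+ k / Gamma (1 + k%:R * alpha))).

(* F is the profile of the fundamental solution in dimension N = 1:
   F is integrable and continuous on R, and its Fourier transform
   \int F(x) e^{-i w x} dx equals E_alpha(-|w|^2) (real and imaginary parts). *)
Definition is_profile (alpha : R) (F : R -> R) : Prop :=
  [/\ leb.-integrable setT (EFin \o F), continuous F,
      (forall w, Rintegral leb setT (fun x => F x * cos (w * x))
                 = mittag_leffler alpha (- w ^+ 2)) &
      (forall w, Rintegral leb setT (fun x => F x * sin (w * x)) = 0)].

Definition fundZ (alpha : R) (F : R -> R) (x t : R) : R :=
  t `^ (- (alpha / 2)) * F (x * t `^ (- (alpha / 2))).

Definition mild_sol (alpha : R) (F : R -> R) (u0 : R -> R) (x t : R) : R :=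
  Rintegral leb setT (fun y => fundZ alpha F (x - y) t * u0 y).

Definition LpB (p : \bar R) (r : R) (f : R -> R) : \bar R :=
  Lnorm leb p (fun x => (\1_(`]- r, r[) x * f x)%:E).

(* x^(-1/p), with the convention 1/oo = 0 *)
Definition pow_minus_invp (p : \bar R) (x : R) : R :=
  match p with
  | r%:E => x `^ (- r^-1)
  | _ => 1
  end.

End Defs.

(* Main.v *)
Require Import Defs.
From HB Require Import structures.
From mathcomp Require Import all_boot all_order all_algebra.
From mathcomp Require Import all_classical all_reals all_analysis.
From mathcomp Require Import measurable_realfun ess_sup_inf.
From mathcomp Require Import ring lra.
Import Order.TTheory GRing.Theory Num.Theory.
Import numFieldNormedType.Exports.
Local Open Scope classical_set_scope.
Local Open Scope ring_scope.

(* The profile F has Fourier transform E_alpha(-w^2), and E_alpha(-s) >= 0 for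
   s >= 0: indeed E_alpha(-s) is the limit of the solutions
     u_n = sum_k (-s / n^alpha)^k binom(n + k alpha, n)
   of the Gruenwald-Letnikov discretization of D^alpha u = -s u, and these are
   nonnegative since the weights of (1 - z)^alpha are nonpositive after the
   first one. The termwise limit is Euler's limit for Gamma, obtained from its
   functional equation and Bernoulli's inequality. A continuous integrable
   function with nonnegative Fourier transform is bounded, because its Poisson
   averages at x are dominated by those at 0. Finally
     t^(alpha/2) u(x,t) - M F(0)
       = int (F((x - y) t^(-alpha/2)) - F(0)) u_0(y) dy,
   which tends to 0 uniformly in |x| < g(t): for |y| <= n by continuity of F
   at 0, for |y| > n by boundedness of F and integrability of u_0. *)

(** * Nonnegativity of binomial sums *)

Section RisingBinomial.
Context {R : realType}.
Implicit Types (x y alpha mu : R).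

(* The coefficient of z^m in (1 - z)^(-x). *)
Definition rbin x (m : nat) : R := \prod_(j < m) ((x + j%:R) / j.+1%:R).

Lemma rbin0 x : rbin x 0 = 1.
Proof. by rewrite /rbin big_ord0. Qed.

Lemma rbinS x m : rbin x m.+1 = rbin x m * ((x + m%:R) / m.+1%:R).
Proof. by rewrite /rbin big_ord_recr. Qed.

Lemma mulS_rbinS x m : m.+1%:R * rbin x m.+1 = (x + m%:R) * rbin x m.
Proof.
rewrite rbinS; have : m.+1%:R != 0 :> R by rewrite pnatr_eq0.
by move=> ?; field.
Qed.

Lemma rbin_ge0 x m : 0 <= x -> 0 <= rbin x m.
Proof. by move=> x0; apply: prodr_ge0 => j _; rewrite divr_ge0 ?addr_ge0. Qed.

Lemma rbin1 m : rbin 1 m = 1.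
Proof.
elim: m => [|m IH]; first exact: rbin0.
by rewrite rbinS IH mul1r nat1r divff// pnatr_eq0.
Qed.

Lemma le_rbin x y m : 0 <= x <= y -> rbin x m <= rbin y m.
Proof.
move=> /andP[x0 xy]; apply: ler_prod => j _.
by rewrite divr_ge0 ?addr_ge0//= ler_pM2r ?invr_gt0// lerD2r.
Qed.

(** The first factor is -alpha and every later factor (j - alpha)/(j + 1) is nonnegative. These are
    the coefficients of (1 - z)^alpha after the leading one. *)
Lemma rbinN_le0 alpha m : 0 < alpha < 1 -> rbin (- alpha) m.+1 <= 0.
Proof.
move=> /andP[a0 a1]; elim: m => [|m IH].
  by rewrite rbinS rbin0 addr0 mul1r divr1 oppr_le0 ltW.
rewrite rbinS mulr_le0_ge0// divr_ge0// -natr1.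
have : 0 <= m%:R :> R by [].
lra.
Qed.

(** Vandermonde convolution, read off from (1 - z)^(-x) (1 - z)^(-y). After multiplying by m + 1 = i
    + (m + 1 - i), [mulS_rbinS] lowers one index in each part, as when differentiating the
    product. *)
Lemma rbinD x y m : \sum_(i < m.+1) rbin x i * rbin y (m - i) = rbin (x + y) m.
Proof.
elim: m => [|m IH]; first by rewrite big_ord1 !rbin0 mulr1.
have m0 : m.+1%:R != 0 :> R by rewrite pnatr_eq0.
apply: (mulfI m0); rewrite mulS_rbinS -IH !mulr_sumr.
transitivity (\sum_(i < m.+2) (i%:R * rbin x i) * rbin y (m.+1 - i) +
   \sum_(i < m.+2) rbin x i * ((m.+1 - i)%:R * rbin y (m.+1 - i))).
  rewrite -big_split/=; apply: eq_bigr => i _.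
  have -> : m.+1%:R = i%:R + (m.+1 - i)%:R :> R.
    by rewrite -natrD subnKC// -ltnS.
  ring.
rewrite big_ord_recl !mul0r add0r [X in _ + X]big_ord_recr/= subnn mul0r mulr0.
rewrite addr0 -big_split/=; apply: eq_bigr => i _.
have im : (i <= m)%N by rewrite -ltnS.
rewrite /bump/= add1n subSS mulS_rbinS subSn// mulS_rbinS natrB//; ring.
Qed.

(** The left side is the binomial coefficient of m + k over m. Convolution with the constant
    sequence [rbin 1] turns row k + 1 into the partial sums of row k, and powers of 2 sum to less
    than the next power. *)
Lemma rbin_le_exp2 k m : rbin k.+1%:R m <= 2 ^+ (m + k).
Proof.
elim: k m => [|k IH] m.
  by rewrite rbin1 addn0 exprn_ege1// ler1n.
rewrite -natr1 -rbinD.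
apply: (@le_trans _ _ (\sum_(i < m.+1) 2 ^+ (i + k))).
  by apply: ler_sum => i _; rewrite rbin1 mulr1.
elim: m => [|m IHm]; first by rewrite big_ord1 !add0n ler_eXn2l ?ltr1n.
rewrite big_ord_recr/= (le_trans (lerD IHm (lexx _)))//.
by rewrite !addSn !addnS !exprS; lra.
Qed.

End RisingBinomial.

(** * Series dominated by a geometric series of ratio 1/2 *)

Section GeometricDomination.
Context {R : realType}.
Implicit Types (a : R^nat) (C : R).

Lemma geometric_dominated_cvg {a C} : (forall k, `|a k| <= C * 2^-1 ^+ k) ->
  cvgn (series a).
Proof.
move=> aC; apply: normed_cvg.
have C0 k : 0 <= C * 2^-1 ^+ k := le_trans (normr_ge0 _) (aC k).
apply: (series_le_cvg _ C0 aC) => // ; apply: is_cvg_geometric_series.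
by rewrite ger0_norm// invf_lt1// ltr1n.
Qed.

(** The blocks from N to N + d telescope. The bound depends on [a] only through [C], so it is
    uniform over a family of series with a common domination. *)
Lemma geometric_dominated_tail {a C} N : (forall k, `|a k| <= C * 2^-1 ^+ k) ->
  `|limn (series a) - series a N| <= 2 * C * 2^-1 ^+ N.
Proof.
move=> aC.
have C0 : 0 <= C by have := le_trans (normr_ge0 _) (aC 0); rewrite expr0 mulr1.
have tail d : `|series a (N + d)%N - series a N| <=
    2 * C * 2^-1 ^+ N - 2 * C * 2^-1 ^+ (N + d).
  elim: d => [|d IH]; first by rewrite addn0 !subrr normr0.
  rewrite addnS seriesSr.
  have -> : series a (N + d)%N + a (N + d)%N - series a N =
    (series a (N + d)%N - series a N) + a (N + d)%N by ring.
  rewrite (le_trans (ler_normD _ _))// (le_trans (lerD IH (aC _)))//.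
  by rewrite exprS; lra.
have cv : `|series a n - series a N| @[n --> \oo] -->
    `|limn (series a) - series a N|.
  apply: cvg_norm; apply: cvgB; last exact: cvg_cst.
  by have := geometric_dominated_cvg aC.
rewrite -(cvg_lim (@Rhausdorff R) cv); apply: limr_le; first exact: cvgP cv.
near=> n; have /subnKC <- : (N <= n)%N by near: n; exists N.
by rewrite (le_trans (tail _))// gerBl// !mulr_ge0// exprn_ge0.
Unshelve. all: by end_near. Qed.

End GeometricDomination.

(** * The discrete analogue of the Mittag-Leffler series *)

Section BinomialMittagLeffler.
Context {R : realType}.
Variables (alpha mu : R).
Hypotheses (alpha01 : 0 < alpha < 1) (mu0 : 0 <= mu) (mu4 : mu <= 4^-1).

(** Summed over k, these are formally the coefficients of z^m in (1 - z)^(alpha - 1) / ((1 -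
    z)^alpha + mu). *)
Definition binomial_term m k := (- mu) ^+ k * rbin (1 + k%:R * alpha) m.
Local Notation term := binomial_term.

Let alpha_ge0 : 0 <= alpha. Proof. by case/andP: alpha01 => /ltW. Qed.

(** Since 1 + k alpha <= k + 1, [rbin_le_exp2] bounds the binomial factor by 2^(m + k), and mu <=
    1/4 leaves the ratio 1/2. *)
Lemma binomial_term_bound m k : `|term m k| <= 2 ^+ m * 2^-1 ^+ k.
Proof.
rewrite /binomial_term normrM normrX normrN (ger0_norm mu0).
rewrite ger0_norm ?rbin_ge0 ?addr_ge0 ?mulr_ge0//.
apply: (@le_trans _ _ (4^-1 ^+ k * 2 ^+ (m + k))).
  rewrite ler_pM ?exprn_ge0//.
  - by rewrite rbin_ge0 ?addr_ge0 ?mulr_ge0.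
  - by rewrite lerXn2r ?nnegrE.
  - rewrite (le_trans _ (rbin_le_exp2 k m))// le_rbin// addr_ge0 ?mulr_ge0//=.
    rewrite -natr1 addrC lerD2r ler_piMr// ltW//.
    by case/andP: alpha01.
rewrite exprD mulrCA -exprMn.
by have -> : (4^-1 * 2 : R) = 2^-1 by lra.
Qed.

Lemma binomial_series_ge0 m : 0 <= limn (series (term m)).
Proof.
have cv i : series (term i) n @[n --> \oo] --> limn (series (term i)).
  exact: geometric_dominated_cvg (binomial_term_bound i).
(* With U(z) the generating function of the sums, this is
   (1 - z)^alpha U(z) = (1 - z)^(alpha - 1) - mu U(z); solving for the leading
   term gives nonnegativity by strong induction. *)
have part i N : \sum_(j < i.+1) rbin (- alpha) j * series (term (i - j)) N.+1 =
    rbin (1 - alpha) i - mu * series (term i) N.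
  under eq_bigr do rewrite seriesEord mulr_sumr.
  (* The weights of (1 - z)^alpha lower the parameter by alpha: the term k = 0 becomes the
     coefficient of (1 - z)^(alpha - 1), and term k + 1 becomes -mu times term k. Hence N + 1 terms
     on the left match N on the right. *)
  rewrite exchange_big/= big_ord_recl/= /binomial_term.
  congr (_ + _).
    rewrite [RHS](_ : _ = rbin (- alpha + 1) i); last by rewrite addrC.
    rewrite -rbinD; apply: eq_bigr => j _.
    by rewrite expr0 mul1r mul0r addr0.
  rewrite seriesEord/= mulr_sumr -sumrN; apply: eq_bigr => k _.
  have -> : 1 + k%:R * alpha = - alpha + (1 + (bump 0 k)%:R * alpha).
    by rewrite /bump add1n -natr1; ring.
  rewrite -rbinD -mulNr !mulr_sumr.
  by apply: eq_bigr => j _; rewrite /bump leq0n add1n exprS; ring.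
have rec i : \sum_(j < i.+1) rbin (- alpha) j * limn (series (term (i - j))) =
    rbin (1 - alpha) i - mu * limn (series (term i)).
  have cvl : \sum_(j < i.+1) rbin (- alpha) j * series (term (i - j)) N.+1
      @[N --> \oo] --> \sum_(j < i.+1) rbin (- alpha) j * limn (series (term (i - j))).
    apply: cvg_big => [|j _]; first exact: add_continuous.
    apply: cvgM; first exact: cvg_cst.
    by rewrite (@cvg_shiftS _ (series (term (i - j)))).
  have cvr : \sum_(j < i.+1) rbin (- alpha) j * series (term (i - j)) N.+1
      @[N --> \oo] --> rbin (1 - alpha) i - mu * limn (series (term i)).
    under eq_cvg do rewrite part.
    by apply: cvgB; [exact: cvg_cst|apply: cvgM => //; exact: cvg_cst].
  by rewrite -(cvg_lim (@Rhausdorff R) cvl) (cvg_lim (@Rhausdorff R) cvr).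
have [n] := ubnP m; elim: n m => // n IH m mn.
have := rec m; rewrite big_ord_recl/= rbin0 mul1r subn0 => recm.
have mu1 : 0 < 1 + mu by rewrite ltr_wpDr.
rewrite -(pmulr_rge0 _ mu1).
have -> : (1 + mu) * limn (series (term m)) = rbin (1 - alpha) m -
    \sum_(i < m) rbin (- alpha) (bump 0 i) * limn (series (term (m - bump 0 i))).
  by apply/eqP; rewrite eq_sym subr_eq; apply/eqP; move: recm; lra.
apply: addr_ge0.
  by rewrite rbin_ge0// subr_ge0 ltW//; case/andP: alpha01.
rewrite -sumrN; apply: sumr_ge0 => i _; rewrite oppr_ge0 mulr_le0_ge0//.
  by rewrite /bump leq0n add1n rbinN_le0.
apply: IH; rewrite (leq_trans _ (ltnSE mn))// /bump leq0n add1n ltn_subrL//=.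
exact: leq_ltn_trans (ltn_ord i).
Qed.

End BinomialMittagLeffler.

(** * Asymptotics of the Gamma function *)

Section ExpDominated.
Context {R : realType}.
Local Notation leb := (@lebesgue_measure R).
Implicit Types (f F : R -> R) (c C l : R).

Lemma cvgy_expRN c : 0 < c -> expR (- (c * x)) @[x --> +oo] --> (0 : R).
Proof.
move=> c0; have := @cvgr_expR R; apply: cvg_comp => /=.
apply/cvgryPge => A; near=> x.
by rewrite mulrC -ler_pdivrMr//; near: x; exact: nbhs_pinfty_ge.
Unshelve. all: by end_near. Qed.

Lemma continuous_expRN c : continuous (fun x : R => expR (- (c * x))).
Proof.
move=> x; apply: (@continuous_comp _ _ _ (fun x => - (c * x)) expR).
  by apply: cvgN; apply: cvgM; [exact: cvg_cst|exact: cvg_id].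
exact: continuous_expR.
Qed.

Lemma measurable_expRN c (D : set R) :
  measurable_fun D (fun x : R => expR (- (c * x))).
Proof.
by apply: measurable_funTS; apply: continuous_measurable_fun; exact: continuous_expRN.
Qed.

Lemma integral_expRN C c : 0 < c -> 0 <= C ->
  (\int[leb]_(x in `[0%R, +oo[) (C * expR (- (c * x)))%:E = (C / c)%:E)%E.
Proof.
move=> c0 C0.
have dF (x : R) : is_derive x 1 (fun x : R => - (C / c) * expR (- (c * x)))
    (C * expR (- (c * x))).
  apply: is_derive_eq; rewrite /GRing.scale/= mulr1; field; exact: lt0r_neq0.
rewrite (@ge0_continuous_FTC2y _ _ (fun x : R => - (C / c) * expR (- (c * x))) 0 0).
- by rewrite mulr0 oppr0 expR0 mulr1 EFinN sub0e oppeK.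
- by move=> x _; rewrite mulr_ge0// expR_ge0.
- apply: continuous_subspaceT => x.
  by apply: cvgM; [exact: cvg_cst|exact: continuous_expRN].
- by rewrite -[X in _ --> X](mulr0 (- (C / c))); apply: cvgM;
    [exact: cvg_cst|exact: cvgy_expRN].
- by move=> x _; apply: ex_derive.
- apply: cvg_at_right_filter.
  by apply: cvgM; [exact: cvg_cst|exact: continuous_expRN].
- by move=> x _; rewrite derive1E derive_val.
Qed.

Lemma integrable_expRN C c : 0 < c -> 0 <= C ->
  leb.-integrable `[0%R, +oo[ (fun x : R => (C * expR (- (c * x)))%:E).
Proof.
move=> c0 C0; apply/integrableP; split.
  by apply/measurable_EFinP/measurable_funM => //; exact: measurable_expRN.
under eq_integral do rewrite /= ger0_norm ?mulr_ge0 ?expR_ge0//.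
by rewrite integral_expRN// ltry.
Qed.

Lemma expRN_dominated_integrable f C c : 0 < c ->
  (forall x : R, 0 <= x -> `|f x| <= C * expR (- (c * x))) ->
  measurable_fun (`[0, +oo[ : set R) f -> leb.-integrable `[0%R, +oo[ (EFin \o f).
Proof.
move=> c0 fC mf.
have C0 : 0 <= C.
  by have := le_trans (normr_ge0 _) (fC 0 (lexx 0)); rewrite mulr0 oppr0 expR0 mulr1.
apply: (le_integrable _ _ _ (integrable_expRN _ _ c0 C0)) => //.
  exact/measurable_EFinP.
move=> x; rewrite /= in_itv/= andbT => x0; rewrite lee_fin.
by rewrite (le_trans (fC x x0))// ler_norm.
Qed.

(** Adding the dominating C e^(-c x) makes the integrand nonnegative, so the fundamental theorem for
    nonnegative integrands applies; the known integral of the added term is then removed. *)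
Lemma expRN_dominated_FTC2y f F C c l : 0 < c ->
  (forall x : R, 0 <= x -> `|f x| <= C * expR (- (c * x))) ->
  {within (`[0, +oo[ : set R), continuous f} ->
  F x @[x --> +oo] --> l ->
  (forall x : R, 0 < x -> is_derive x 1 F (f x)) ->
  F x @[x --> 0^'+] --> F 0 ->
  Rintegral leb `[0, +oo[ f = l - F 0.
Proof.
move=> c0 fC cf Fl dF F0.
have C0 : 0 <= C.
  by have := le_trans (normr_ge0 _) (fC 0 (lexx 0)); rewrite mulr0 oppr0 expR0 mulr1.
have mf : measurable_fun (`[0, +oo[ : set R) f by exact: subspace_continuous_measurable_fun.
have intf := expRN_dominated_integrable _ _ _ c0 fC mf.
have intg := integrable_expRN _ _ c0 C0.
pose g x := C * expR (- (c * x)).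
have dG (x : R) : is_derive x 1 (fun x : R => - (C / c) * expR (- (c * x))) (g x).
  apply: is_derive_eq; rewrite /g /GRing.scale/= mulr1; field; exact: lt0r_neq0.
have cg x : {for x, continuous g}.
  by apply: cvgM; [exact: cvg_cst|exact: continuous_expRN].
have cG x : {for x, continuous (fun x : R => - (C / c) * expR (- (c * x)))}.
  by apply: cvgM; [exact: cvg_cst|exact: continuous_expRN].
have : Rintegral leb `[0, +oo[ (f \+ g) =
    l - (F 0 + - (C / c) * expR (- (c * 0))).
  apply: (@Rintegral_ge0_continuous_FTC2y _ _
    (fun x => F x + - (C / c) * expR (- (c * x)))) => /=.
  - by move=> x x0; have := fC x x0; rewrite ler_norml /g => /andP[+ _]; lra.
  - move=> x; apply: cvgD; first exact: cf.
    by apply: (@continuous_subspaceT _ _ _ g) => z; exact: cg.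
  - rewrite -[X in _ --> X]addr0; apply: cvgD => //.
    by rewrite -[X in _ --> X](mulr0 (- (C / c))); apply: cvgM;
      [exact: cvg_cst|exact: cvgy_expRN].
  - by move=> x x0; have ? := dF x x0; apply: ex_derive.
  - by apply: cvgD => //; apply: cvg_at_right_filter; exact: cG.
  - move=> x; rewrite in_itv/= andbT => x0; have ? := dF x x0.
    by rewrite derive1E derive_val.
rewrite RintegralD//= {2}/Rintegral integral_expRN//= mulr0 oppr0 expR0.
lra.
Qed.

End ExpDominated.

(** * Functional equation and Euler's limit for Gamma *)

Section GammaAsymptotics.
Context {R : realType}.
Local Notation leb := (@lebesgue_measure R).
Implicit Types (x y z : R).

(** Tangent line of z^(-x) at z = 1, from e^u >= 1 + u with u = -x ln z and from ln z <= z - 1. *)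
Lemma powR_ge1DN x z : 0 <= x -> 0 < z -> 1 + x - x * z <= z `^ (- x).
Proof.
move=> x0 z0; rewrite /powR gt_eqF//; apply: le_trans (expR_ge1Dx _).
have /(ler_wpM2l x0) : ln z <= z - 1.
  by rewrite -{1}(subrK 1 z) addrC le_ln1Dx// ltrBrDr addNr.
lra.
Qed.

Lemma powR_ge1D x z : 0 <= x -> 0 < z -> 1 + x - x / z <= z `^ x.
Proof.
move=> x0 z0; have zV : 0 < z^-1 by rewrite invr_gt0.
by have := powR_ge1DN _ _ x0 zV; rewrite -{2}(powR_inv1 (ltW z0)) -powRrM mulN1r opprK.
Qed.

(** The constant (2x)^x comes from raising y/(2x) <= e^(y/(2x)) to the power x, which costs half of
    the exponential. *)
Lemma powR_expR_bound x : 0 <= x -> exists2 C, 0 <= C &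
  forall y, 0 <= y -> y `^ x * expR (- y) <= C * expR (- (2^-1 * y)).
Proof.
move=> x0; exists ((2 * x) `^ x); first exact: powR_ge0.
move=> y y0.
have -> : expR (- y) = expR (- (2^-1 * y)) * expR (- (2^-1 * y)).
  by rewrite -expRD; congr expR; lra.
rewrite mulrA ler_wpM2r ?expR_ge0// expRN ler_pdivrMr ?expR_gt0//.
have [->|xn0] := eqVneq x 0.
  by rewrite !powRr0 mul1r -expR0 ler_expR mulr_ge0.
have xp : 0 < x by rewrite lt_neqAle eq_sym xn0.
have -> : expR (2^-1 * y) = expR (y / (2 * x)) `^ x.
  by rewrite -expRM; congr expR; field.
rewrite -powRM ?expR_ge0 ?mulr_ge0// ge0_ler_powR ?nnegrE ?mulr_ge0 ?expR_ge0//.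
rewrite -ler_pdivrMl ?mulr_gt0// mulrC (le_trans _ (expR_ge1Dx _))//.
by rewrite ler_wpDl.
Qed.

Lemma continuous_expR1N : continuous (fun y : R => expR (- y)).
Proof.
by move=> y; have := @continuous_expRN R 1 y; under eq_fun do rewrite mul1r.
Qed.

Lemma measurable_Gamma_integrand x (D : set R) :
  measurable_fun D (fun y : R => y `^ x * expR (- y)).
Proof.
apply: measurable_funM; first by apply: measurable_funTS; exact: measurable_powR.
by apply: measurable_funTS; apply: continuous_measurable_fun; exact: continuous_expR1N.
Qed.

Lemma integrable_Gamma x : 0 <= x ->
  leb.-integrable `]0, +oo[ (EFin \o (fun y => y `^ x * expR (- y))).
Proof.
move=> x0; have [C C0 bC] := powR_expR_bound _ x0.
apply: (@integrableS _ _ _ leb `[0, +oo[) => //.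
  by apply: subset_itvr; rewrite bnd_simp.
apply: (expRN_dominated_integrable _ C 2^-1).
- by rewrite invr_gt0.
- by move=> y y0; rewrite ger0_norm ?mulr_ge0 ?powR_ge0 ?expR_ge0//; exact: bC.
- exact: measurable_Gamma_integrand.
Qed.

(** Gamma is handled at 1 + x with x >= 0 throughout: the integrand is then bounded near 0, and
    these are the values in the Mittag-Leffler coefficients. *)
Lemma Gamma1D x : Gamma (1 + x) =
  Rintegral leb `]0, +oo[ (fun y => y `^ x * expR (- y)).
Proof. by rewrite /Gamma; under eq_Rintegral do rewrite (addrC 1) addrK. Qed.

Lemma within_continuous_powR x : 0 <= x ->
  {within (`[0, +oo[ : set R), continuous (@powR R ^~ x)}.
Proof.
move=> x0; apply/continuous_within_itvcyP; split.
  move=> y; rewrite in_itv/= andbT => y0.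
  by apply: differentiable_continuous; apply/derivable1_diffP/derivable_powR;
    rewrite in_itv/= y0.
have [->|xn0] := eqVneq x 0.
  under eq_cvg do rewrite powRr0.
  by rewrite powRr0; exact: cvg_cst.
by rewrite powR0//; apply: powR_cvg0; rewrite lt_neqAle eq_sym xn0.
Qed.

(** Integration by parts: (x + 1) y^x e^(-y) - y^(x + 1) e^(-y) is the derivative of y^(x + 1)
    e^(-y), which vanishes at 0 and at infinity. *)
Lemma Gamma1DS x : 0 <= x -> Gamma (1 + (x + 1)) = (x + 1) * Gamma (1 + x).
Proof.
move=> x0; have x10 : 0 <= x + 1 by rewrite addr_ge0.
have int0 := integrable_Gamma _ x0; have int1 := integrable_Gamma _ x10.
have int0' : leb.-integrable `]0, +oo[
    (EFin \o (fun y => (x + 1) * (y `^ x * expR (- y)))).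
  by have := integrableZl _ (x + 1) int0; exact.
have [C0 _ b0] := powR_expR_bound _ x0.
have [C1 _ b1] := powR_expR_bound _ x10.
rewrite !Gamma1D -RintegralZl//.
apply/eqP; rewrite eq_sym -subr_eq0 -RintegralB//; apply/eqP.
rewrite Rintegral_itv_obnd_cbnd; last exact: (integrableB _ int0' int1).
have cont a : 0 <= a -> {within (`[0, +oo[ : set R),
    continuous (fun y : R => y `^ a * expR (- y))}.
  move=> a0 y; apply: cvgM; first exact: within_continuous_powR.
  by apply: (@continuous_subspaceT _ _ _ (fun y : R => expR (- y)));
    exact: continuous_expR1N.
transitivity (0 - 0 `^ (x + 1) * expR (- 0) : R); last first.
  by rewrite powR0 ?mul0r ?subrr// gt_eqF// ltr_wpDl.
apply: (@expRN_dominated_FTC2y _ _ (fun y => y `^ (x + 1) * expR (- y))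
  ((x + 1) * C0 + C1) 2^-1 0).
- by rewrite invr_gt0.
- move=> y y0 /=; rewrite (le_trans (ler_normB _ _))// (mulrDl (_ * C0)) lerD//.
    rewrite normrM ger0_norm// -mulrA ler_wpM2l//.
    by rewrite ger0_norm ?mulr_ge0 ?powR_ge0 ?expR_ge0//; exact: b0.
  by rewrite ger0_norm ?mulr_ge0 ?powR_ge0 ?expR_ge0//; exact: b1.
- move=> y; apply: cvgB; last exact: cont.
  by apply: cvgM; [exact: cvg_cst|exact: cont].
- apply: (@squeeze_cvgr _ _ _ _ (cst 0) (fun y => C1 * expR (- (2^-1 * y)))).
  + near=> y; have y0 : 0 <= y by near: y; exact: nbhs_pinfty_ge.
    by rewrite b1// mulr_ge0 ?powR_ge0 ?expR_ge0.
  + exact: cvg_cst.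
  + rewrite -[X in _ --> X](mulr0 C1); apply: cvgM; first exact: cvg_cst.
    by apply: cvgy_expRN; rewrite invr_gt0.
- move=> y y0; have ? := is_derive1_powR (x + 1) y0.
  apply: is_derive_eq; rewrite /GRing.scale/= addrK; ring.
- by move/continuous_within_itvcyP : (cont _ x10) => [].
Unshelve. all: by end_near. Qed.

Local Notation gin x y := (y `^ x * expR (- y)).

(** Multiplying by e^(-y) and integrating turns tangent-line bounds on powers into inequalities
    between Gamma values. *)
Lemma Gamma1D_comb_le (k l a b c : R) : 0 <= a -> 0 <= b -> 0 <= c ->
  (forall y, 0 < y -> k * y `^ a - l * y `^ b <= y `^ c) ->
  k * Gamma (1 + a) - l * Gamma (1 + b) <= Gamma (1 + c).
Proof.
move=> a0 b0 c0 H; rewrite !Gamma1D.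
have mulint e d : 0 <= d -> leb.-integrable `]0, +oo[ (EFin \o (fun y => e * gin d y)).
  by move=> d0; have := integrableZl _ e (integrable_Gamma _ d0); exact.
rewrite -!RintegralZl//; try exact: integrable_Gamma.
rewrite -RintegralB//; [|exact: (mulint k a)|exact: (mulint l b)].
apply: le_Rintegral => //; last 2 first.
- exact: integrable_Gamma.
- move=> y; rewrite /= in_itv/= andbT => y0.
  by rewrite !mulrA -mulrBl ler_wpM2r ?expR_ge0// H.
- exact: (integrableB _ (mulint k a a0) (mulint l b b0)).
Qed.

Lemma Gamma1D0 : Gamma (1 + 0) = 1 :> R.
Proof.
rewrite Gamma1D Rintegral_itv_obnd_cbnd; last exact: integrable_Gamma.
under eq_Rintegral do rewrite powRr0 -[X in expR (- X)]mul1r.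
by rewrite /Rintegral integral_expRN//= divr1.
Qed.

(* Integrates the tangent-line bound y^x >= N^x (1 + x - x N / y) at N = b + 1
   against y^(b+1) e^(-y); Gamma1D_shift_le does the same for y^(-x). *)
Lemma Gamma1D_shift_ge x b : 0 <= x -> 0 <= b ->
  (b + 1) `^ x * Gamma (1 + (b + 1)) <= Gamma (1 + (b + 1 + x)).
Proof.
move=> x0 b0; have b1 : 0 < b + 1 by rewrite ltr_wpDl.
(* The tangent point b + 1 is the one for which, by the functional equation, the two correction
   terms cancel after integration. *)
have -> : (b + 1) `^ x * Gamma (1 + (b + 1)) =
    ((b + 1) `^ x * (1 + x)) * Gamma (1 + (b + 1)) -
    ((b + 1) `^ x * (x * (b + 1))) * Gamma (1 + b).
  by rewrite (Gamma1DS _ b0); ring.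
apply: Gamma1D_comb_le; rewrite ?addr_ge0// => y y0.
have z0 : 0 < y / (b + 1) by rewrite divr_gt0.
have yb : y = y / (b + 1) * (b + 1) by rewrite divfK// gt_eqF.
have -> : y `^ (b + 1 + x) = y `^ (b + 1) * ((b + 1) `^ x * (y / (b + 1)) `^ x).
  rewrite powRD; last by rewrite (gt_eqF y0) implybT.
  by rewrite -powRM ?ltW// [(b + 1) * _]mulrC -yb.
have -> : y `^ (b + 1) = y `^ b * y.
  by rewrite powRD ?powRr1 ?ltW// (gt_eqF y0) implybT.
have := ler_wpM2l (mulr_ge0 (mulr_ge0 (powR_ge0 y b) (ltW y0)) (powR_ge0 (b + 1) x))
  (powR_ge1D _ _ x0 z0).
congr (is_true (_ <= _)); last by rewrite mulrA.
by field; rewrite ?(gt_eqF y0) ?gt_eqF.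
Qed.

Lemma Gamma1D_shift_le x b : 0 <= x -> 0 <= b ->
  Gamma (1 + (b + x)) <= (b + x + 1) `^ x * Gamma (1 + b).
Proof.
move=> x0 b0; have N0 : 0 < b + x + 1 by rewrite ltr_wpDl// addr_ge0.
have bx : 0 <= b + x by rewrite addr_ge0.
rewrite -ler_pdivrMl ?powR_gt0// -powRN.
(* Here the corrections cancel for the tangent point b + x + 1, the integration being against y^(b +
   x) e^(-y). *)
have -> : (b + x + 1) `^ (- x) * Gamma (1 + (b + x)) =
    ((b + x + 1) `^ (- x) * (1 + x)) * Gamma (1 + (b + x)) -
    ((b + x + 1) `^ (- x) * (x / (b + x + 1))) * Gamma (1 + (b + x + 1)).
  by rewrite (Gamma1DS _ bx); field; rewrite gt_eqF.
apply: Gamma1D_comb_le; rewrite ?addr_ge0// => y y0.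
set N := b + x + 1.
have z0 : 0 < y / N by rewrite divr_gt0.
have yb : y = y / N * N by rewrite divfK// gt_eqF.
have -> : y `^ b = y `^ (b + x) * (N `^ (- x) * (y / N) `^ (- x)).
  rewrite -powRM ?ltW// [N * _]mulrC -yb.
  rewrite -powRD; last by rewrite (gt_eqF y0) implybT.
  by congr (_ `^ _); ring.
have -> : y `^ N = y `^ (b + x) * y.
  by rewrite powRD ?powRr1 ?ltW// (gt_eqF y0) implybT.
have := ler_wpM2l (mulr_ge0 (powR_ge0 y (b + x)) (powR_ge0 N (- x)))
  (powR_ge1DN _ _ x0 z0).
congr (is_true (_ <= _)); last by rewrite mulrA.
by field; rewrite ?(gt_eqF y0) ?gt_eqF.
Qed.

(** At b = 0 the lower shift inequality reads 1 <= (x + 1) Gamma(1 + x). *)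
Lemma Gamma1D_gt0 x : 0 <= x -> 0 < Gamma (1 + x).
Proof.
move=> x0; have := Gamma1D_shift_ge _ _ x0 (lexx 0).
rewrite (_ : 0 + 1 + x = x + 1); last by ring.
rewrite (Gamma1DS _ (lexx 0)) (Gamma1DS _ x0) add0r powR1 Gamma1D0 !mul1r => h.
have x10 : 0 < x + 1 by rewrite ltr_wpDl.
by rewrite -(pmulr_rgt0 _ x10) (lt_le_trans _ h).
Qed.

Lemma Gamma1D_rbin x n : 0 <= x ->
  Gamma (1 + (x + n%:R)) = n`!%:R * rbin (1 + x) n * Gamma (1 + x).
Proof.
move=> x0; elim: n => [|n IH]; first by rewrite addr0 rbin0 !mul1r.
rewrite -natr1 (addrA x) Gamma1DS ?addr_ge0// IH factS natrM.
rewrite [n.+1%:R * _]mulrC -[_ * rbin _ n.+1]mulrA mulS_rbinS; ring.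
Qed.

Lemma Gamma1D_nat n : Gamma (1 + n%:R) = n`!%:R :> R.
Proof. by have := Gamma1D_rbin 0 n (lexx 0); rewrite Gamma1D0 add0r addr0 rbin1 !mulr1. Qed.

(** By [Gamma1D_rbin], the product of [rbin (1 + x) n.+1] and Gamma(1 + x) is Gamma(n + 2 + x)/(n +
    1)!, which the shift inequalities place between (n + 1)^x and (n + x + 2)^x. *)
Lemma cvg_rbin_Gamma x : 0 <= x ->
  rbin (1 + x) n.+1 / n.+1%:R `^ x @[n --> \oo] --> (Gamma (1 + x))^-1.
Proof.
move=> x0; have G0 := Gamma1D_gt0 _ x0.
(* The ratio of the upper to the lower bound; it is squeezed to 1 by 1 + u <= e^u with u = (x +
   1)/(n + 1). *)
pose r (n : nat) : R := ((n.+1%:R + x + 1) / n.+1%:R) `^ x.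
have r1 : r n @[n --> \oo] --> (1 : R).
  have -> : (1 : R) = expR (x * 0) by rewrite mulr0 expR0.
  apply: (@squeeze_cvgr _ _ _ _ (cst 1) (fun n => expR (x * ((x + 1) * n.+1%:R^-1)))).
  - near=> n; have n0 : 0 < n.+1%:R :> R by [].
    have -> : r n = (1 + (x + 1) / n.+1%:R) `^ x.
      by rewrite /r -addrA mulrDl divff// gt_eqF.
    have h0 : 0 <= (x + 1) / n.+1%:R by rewrite divr_ge0// addr_ge0.
    apply/andP; split.
      apply: (@le_trans _ _ (1 `^ x)); first by rewrite powR1.
      by rewrite ge0_ler_powR ?nnegrE ?addr_ge0// lerDl.
    rewrite [x * _]mulrC expRM ge0_ler_powR ?nnegrE ?addr_ge0 ?expR_ge0//.
    exact: expR_ge1Dx.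
  - by rewrite mulr0 expR0; exact: cvg_cst.
  - apply: (@cvg_comp _ _ _ _ expR _ (nbhs (x * 0))); last exact: continuous_expR.
    apply: cvgM; first exact: cvg_cst.
    rewrite -(mulr0 (x + 1)); apply: cvgM; first exact: cvg_cst.
    exact: cvg_harmonic.
apply: (@squeeze_cvgr _ _ _ _ (cst (Gamma (1 + x))^-1)
    (fun n => r n * (Gamma (1 + x))^-1)); last 2 first.
- exact: cvg_cst.
- by rewrite -[X in _ --> X]mul1r; apply: cvgM => //; exact: cvg_cst.
near=> n; have n0 : 0 < n.+1%:R :> R by [].
have p0 : 0 < n.+1%:R `^ x :> R by exact: powR_gt0.
have f0 : 0 < n.+1`!%:R :> R by rewrite ltr0n fact_gt0.
have GE : Gamma (1 + (n.+1%:R + x)) = n.+1`!%:R * (rbin (1 + x) n.+1 * Gamma (1 + x)).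
  by rewrite [n.+1%:R + x]addrC Gamma1D_rbin// mulrA.
have := Gamma1D_shift_ge _ _ x0 (ler0n R n).
rewrite natr1 GE Gamma1D_nat mulrC ler_pM2l// => hge.
have := Gamma1D_shift_le _ _ x0 (ler0n R n.+1).
rewrite GE Gamma1D_nat mulrC [leRHS]mulrC mulrC ler_pM2l// => hle.
have rE : r n = (n.+1%:R + x + 1) `^ x / n.+1%:R `^ x.
  by rewrite /r powRM ?addr_ge0// -powR_inv1// -powRrM mulN1r powRN.
apply/andP; split; first by rewrite /= ler_pdivlMr// mulrC ler_pdivrMr.
by rewrite rE -!mulrA [_ / Gamma _]mulrC mulrA ler_pM2r ?invr_gt0// ler_pdivlMr.
Unshelve. all: by end_near. Qed.

End GammaAsymptotics.

(** * Nonnegativity of the Mittag-Leffler function *)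

Section MittagLefflerNonnegative.
Context {R : realType}.
Implicit Types (x s alpha : R).

(** The ratio of consecutive values is at most 1 by [powR_ge1D] at (k + 2)/(k + 1). This lets one
    index dominate all later ones. *)
Lemma rbin_powR_nonincreasing x m n : 0 <= x -> (m <= n)%N ->
  rbin (1 + x) n.+1 / n.+1%:R `^ x <= rbin (1 + x) m.+1 / m.+1%:R `^ x.
Proof.
move=> x0 /subnKC <-; elim: (n - m)%N => [|d IH]; first by rewrite addn0.
apply: le_trans IH; rewrite addnS; move: (m + d)%N => k.
have k0 : 0 < k.+1%:R :> R by [].
have k1 : 0 < k.+2%:R :> R by [].
rewrite rbinS ler_pdivrMr ?powR_gt0// -!mulrA ler_wpM2l//.
  by rewrite rbin_ge0// addr_ge0.
have := @powR_ge1D R x (k.+2%:R / k.+1%:R) x0 (divr_gt0 k1 k0).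
have -> : (k.+2%:R / k.+1%:R) `^ x = (k.+1%:R `^ x)^-1 * k.+2%:R `^ x :> R.
  by rewrite powRM ?invr_ge0// mulrC -(powR_inv1 (ltW k0)) -powRrM mulN1r powRN.
apply: le_trans; rewrite le_eqVlt; apply/orP; left; apply/eqP.
have : k.+2%:R = k.+1%:R + 1 :> R by rewrite natr1.
move: k0 k1; set a := k.+1%:R => k0 k1 ->.
by field; rewrite !gt_eqF// ltr_wpDl// ltW.
Qed.

Lemma mittag_leffler_ge0 alpha s : 0 < alpha < 1 -> 0 <= s ->
  0 <= mittag_leffler alpha (- s).
Proof.
move=> alpha01 s0; have /andP[a0 a1] := alpha01.
(* Tannery: the sums with mu = s / (n+1)^alpha are nonnegative, dominated by a
   geometric series uniformly in n, and converge termwise by cvg_rbin_Gamma. *)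
pose f k : R := (- s) ^+ k / Gamma (1 + k%:R * alpha).
pose mu n : R := s / n.+1%:R `^ alpha.
pose term n k : R := (- mu n) ^+ k * rbin (1 + k%:R * alpha) n.+1.
have mu0 n : 0 <= mu n by rewrite divr_ge0// powR_ge0.
have ka0 k : 0 <= k%:R * alpha by rewrite mulr_ge0// ltW.
have termE n k : term n k = (- s) ^+ k *
    (rbin (1 + k%:R * alpha) n.+1 / n.+1%:R `^ (k%:R * alpha)).
  rewrite /term /mu -mulNr exprMn exprVn -(powR_mulrn k (powR_ge0 _ alpha)) -powRrM.
  by rewrite [alpha * _]mulrC; ring.
have cvterm k : term n k @[n --> \oo] --> f k.
  under eq_cvg do rewrite termE.
  by apply: cvgM; [exact: cvg_cst|exact: cvg_rbin_Gamma].
have [n0 n0P] : exists n0, forall n, (n0 <= n)%N -> mu n <= 4^-1.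
  (* mu n <= 1/4 means (n + 1)^alpha >= 4 s, that is n + 1 >= (4 s)^(1/alpha). *)
  exists (Num.trunc ((4 * s) `^ alpha^-1)).+1 => n n0n.
  rewrite /mu ler_pdivrMr ?powR_gt0// mulrC ler_pdivlMr//.
  have -> : s * 4 = ((4 * s) `^ alpha^-1) `^ alpha.
    by rewrite -powRrM mulVf ?gt_eqF// powRr1 ?mulr_ge0// mulrC.
  rewrite ge0_ler_powR ?nnegrE ?powR_ge0 ?(ltW a0)//.
  rewrite (le_trans (ltW (truncnS_gt _)))// ler_nat; exact: leqW.
pose C : R := 2 ^+ n0.+1.
(* The factor 2^(n + 1) of [binomial_term_bound] grows with n; monotonicity in n reduces to n = n0,
   where it is the constant [C]. *)
have bterm n k : (n0 <= n)%N -> `|term n k| <= C * 2^-1 ^+ k.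
  move=> n0n; apply: (@le_trans _ _ `|term n0 k|).
    have r0 m : 0 <= rbin (1 + k%:R * alpha) m.+1 / m.+1%:R `^ (k%:R * alpha).
      by rewrite divr_ge0 ?powR_ge0// rbin_ge0// addr_ge0.
    rewrite !termE !(normrM ((- s) ^+ k)) ler_wpM2l// !ger0_norm//.
    exact: rbin_powR_nonincreasing.
  exact: (binomial_term_bound _ _ alpha01 (mu0 n0) (n0P n0 (leqnn _))).
have bf k : `|f k| <= C * 2^-1 ^+ k.
  apply: (cvgr_to_le (cvg_norm (cvterm k))).
  by near=> n; apply: bterm; near: n; exists n0.
(* The full sum at level n is nonnegative, so its N-th partial sum is at least minus the tail.
   Letting n grow with N fixed keeps this bound; N goes to infinity afterwards. *)
have partf N : - (2 * C * 2^-1 ^+ N) <= series f N.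
  have cvs : series (term n) N @[n --> \oo] --> series f N.
    rewrite seriesEord; under eq_cvg do rewrite seriesEord.
    apply: cvg_big => [|k _]; first exact: add_continuous.
    exact: cvterm.
  apply: (cvgr_to_ge cvs); near=> n; have n0n : (n0 <= n)%N by near: n; exists n0.
  have bt k := bterm n k n0n.
  have := geometric_dominated_tail N bt.
  have : 0 <= limn (series (term n)).
    exact: (binomial_series_ge0 _ _ alpha01 (mu0 n) (n0P n n0n)).
  by rewrite ler_norml => ? /andP[_]; lra.
have cf := geometric_dominated_cvg bf.
have c0 : - (2 * C * 2^-1 ^+ N) @[N --> \oo] --> (0 : R).
  rewrite -oppr0 -[X in _ --> - X](mulr0 (2 * C)); apply: cvgN.
  apply: cvgM; first exact: cvg_cst.
  by apply: cvg_expr; rewrite ger0_norm// invf_lt1// ltr1n.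
by apply: (ler_cvg_to c0 cf); exact: nearW.
Unshelve. all: by end_near. Qed.

End MittagLefflerNonnegative.

(** * Boundedness of the profile *)

Section BoundedProduct.
Context {R : realType}.
Local Notation leb := (@lebesgue_measure R).
Implicit Types (f e k : R -> R).

Lemma integrable_mul_bounded f k (M : R) : leb.-integrable setT (EFin \o f) ->
  measurable_fun setT k -> (forall x, `|k x| <= M) ->
  leb.-integrable setT (EFin \o (fun x => f x * k x)).
Proof.
move=> intf mk kM; have /integrableP[/measurable_EFinP mf _] := intf.
have intMf := integrableZl measurableT M (integrable_abse intf).
apply: (le_integrable _ _ _ intMf) => //.
  by apply/measurable_EFinP/measurable_funM.
move=> x _; rewrite /= lee_fin normrM (ger0_norm (mulr_ge0 _ _))//.
  by rewrite mulrC ler_wpM2r.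
exact: le_trans (kM x).
Qed.

(** The integrand is at most |f(y)| |e(w)|, whose double integral is the product of two finite L1
    norms. It is applied with a cosine for [k]. *)
Lemma Fubini_mul_bounded f e (k : R * R -> R) :
  leb.-integrable setT (EFin \o f) -> leb.-integrable setT (EFin \o e) ->
  measurable_fun setT k -> (forall z, `|k z| <= 1) ->
  let h y := Rintegral leb setT (fun w => f y * e w * k (y, w)) in
  leb.-integrable setT (EFin \o h) /\
  Rintegral leb setT h =
    Rintegral leb setT (fun w => Rintegral leb setT (fun y => f y * e w * k (y, w))).
Proof.
move=> intf inte mk k1 h.
have /integrableP[/measurable_EFinP mf _] := intf.
have /integrableP[/measurable_EFinP me _] := inte.
pose H (z : R * R) := f z.1 * e z.2 * k z.
have mH : measurable_fun setT H.
  apply: measurable_funM => //; apply: measurable_funM.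
    exact: measurableT_comp.
  exact: measurableT_comp.
have mky y : measurable_fun setT (fun w => k (y, w)).
  exact: measurableT_comp.
have mHy y : measurable_fun setT (fun w => H (y, w)).
  exact: measurableT_comp.
have mkw w : measurable_fun setT (fun y => k (y, w)).
  exact: measurableT_comp.
have intw y : leb.-integrable setT (EFin \o (fun w => f y * e w * k (y, w))).
  apply: (integrable_mul_bounded _ _ 1) => //.
  by have := integrableZl measurableT (f y) inte; exact.
have inty w : leb.-integrable setT (EFin \o (fun y => f y * e w * k (y, w))).
  apply: (integrable_mul_bounded _ _ 1) => //.
  by have := integrableZr measurableT (e w) intf; exact.
have intH : (leb \x leb)%E.-integrable setT (EFin \o H).
  apply/integrable12ltyP; first exact/measurable_EFinP.
  apply: (@le_lt_trans _ _ (\int[leb]_y (`|f y|%:E * \int[leb]_w `|(e w)%:E|))%E).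
    apply: ge0_le_integral => //.
    - by move=> y _; exact: integral_ge0.
    - apply: (@measurable_fun_fubini_tonelli_F _ _ _ _ _ leb (abse \o (EFin \o H))).
        by apply: measurableT_comp => //; exact/measurable_EFinP.
      by move=> z; exact: abse_ge0.
    - under eq_fun do rewrite muleC; apply: measurable_funeM.
      by apply/measurable_EFinP; exact: measurableT_comp.
    - move=> y _; rewrite -ge0_integralZl//=.
      + apply: ge0_le_integral => //=.
        * by apply/measurable_EFinP; apply: (measurableT_comp _ (mHy y)).
        * by apply/measurable_EFinP; apply: measurable_funM => //; exact: measurableT_comp.
        * by move=> w _; rewrite lee_fin !normrM ler_piMr// mulr_ge0.
      + by apply/measurable_EFinP; exact: measurableT_comp.
  rewrite ge0_integralZr//=.
  - have /integrableP[_ +] := intf; have /integrableP[_ +] := inte => /= elt flt.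
    by rewrite lte_mul_pinfty ?integral_ge0// ge0_fin_numE ?integral_ge0.
  - by apply/measurable_EFinP; exact: measurableT_comp.
  - exact: integral_ge0.
have hE : EFin \o h = (fun y => \int[leb]_w (EFin \o H) (y, w))%E.
  apply/funext => y; rewrite /h /Rintegral /= fineK//.
  exact: (integrable_fin_num measurableT (intw y)).
split; first by rewrite hE; exact: integrable_fubini_F.
rewrite /Rintegral; congr fine.
have -> : (\int[leb]_y (h y)%:E = \int[leb]_y \int[leb]_w (EFin \o H) (y, w))%E.
  by rewrite -hE.
rewrite Fubini//; apply: eq_integral => w _.
by rewrite fineK//; exact: (integrable_fin_num measurableT (inty w)).
Qed.

End BoundedProduct.

(** * The Poisson kernel as a damped cosine integral *)

Section PoissonKernel.
Context {R : realType}.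
Local Notation leb := (@lebesgue_measure R).
Implicit Types (c x y w : R).

(** The damping makes Fourier inversion absolutely convergent; extension by zero lets Fubini be used
    on the whole plane. *)
Definition abel_weight c w : R := \1_(`[0, +oo[%classic : set R) w * expR (- (c * w)).

(** Poisson kernel of the half-plane at height c, normalized to total mass pi. *)
Definition poisson_kernel c y : R := c / (c ^+ 2 + y ^+ 2).

Lemma abel_weight_ge0 c w : 0 <= abel_weight c w.
Proof. by rewrite mulr_ge0 ?expR_ge0. Qed.

Lemma poisson_kernel_ge0 c y : 0 <= c -> 0 <= poisson_kernel c y.
Proof. by move=> c0; rewrite divr_ge0 ?addr_ge0 ?sqr_ge0. Qed.

Lemma poisson_kernel_le c y : 0 < c -> poisson_kernel c y <= c^-1.
Proof.
move=> c0; rewrite /poisson_kernel ler_pdivrMr; last first.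
  by rewrite ltr_wpDr ?sqr_ge0// exprn_gt0.
by rewrite mulrDr expr2 mulKf ?gt_eqF// lerDl mulr_ge0 ?sqr_ge0 ?invr_ge0 ?ltW.
Qed.

Lemma continuous_poisson_kernel c : 0 < c -> continuous (poisson_kernel c).
Proof.
move=> c0 y; have d0 : c ^+ 2 + y ^+ 2 != 0.
  by rewrite gt_eqF// ltr_wpDr ?sqr_ge0// exprn_gt0.
apply: cvgM; first exact: cvg_cst.
apply: cvgV => //; apply: cvgD; first exact: cvg_cst.
exact: exprn_continuous.
Qed.

Lemma measurable_poisson_kernel c : 0 < c -> measurable_fun setT (poisson_kernel c).
Proof.
by move=> c0; apply: continuous_measurable_fun; exact: continuous_poisson_kernel.
Qed.

(** The antiderivative atan(x/c) takes values between -pi/2 and pi/2, so the bound is uniform in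
    c. *)
Lemma Rintegral_poisson_kernel_le c a b : 0 < c -> a < b ->
  Rintegral leb `[a, b] (poisson_kernel c) <= pi.
Proof.
move=> c0 ab; pose G x := atan (c^-1 * x).
have dG (x : R) : is_derive x 1 G (poisson_kernel c x).
  apply: is_derive_eq; rewrite /GRing.scale/= /poisson_kernel.
  by field; rewrite ?gt_eqF// ltr_wpDr ?sqr_ge0// exprn_gt0.
have cG x : {for x, continuous G}.
  by apply: differentiable_continuous; apply/derivable1_diffP; apply: ex_derive.
rewrite /Rintegral (continuous_FTC2 ab (F := G)).
- rewrite /= /G; have := atan_ltpi2 (c^-1 * b); have := atan_gtNpi2 (c^-1 * a).
  lra.
- by apply: continuous_subspaceT; exact: continuous_poisson_kernel.
- split.
  + by move=> x _; apply: ex_derive.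
  + by apply: cvg_at_right_filter; exact: cG.
  + by apply: cvg_at_left_filter; exact: cG.
- by move=> x _; rewrite derive1E derive_val.
Qed.

Lemma Rintegral_abel_weight c (f : R -> R) :
  Rintegral leb setT (fun w => abel_weight c w * f w) =
  Rintegral leb `[0, +oo[ (fun w => expR (- (c * w)) * f w).
Proof.
rewrite [RHS]Rintegral_mkcond; apply: eq_Rintegral => w _.
rewrite patchE /abel_weight indicE; case: ifP => _; first by rewrite mul1r.
by rewrite !mul0r.
Qed.

Lemma integrable_abel_weight c : 0 < c ->
  leb.-integrable setT (EFin \o abel_weight c).
Proof.
move=> c0.
have -> : EFin \o abel_weight c =
    (fun w => (1 * expR (- (c * w)))%:E) \_ (`[0, +oo[%classic : set R).
  apply/funext => w /=; rewrite /abel_weight patchE indicE.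
  by case: ifP => _; rewrite ?mul1r ?mul0r.
by apply: (iffLR (integrable_mkcond _ _)) => //; exact: (integrable_expRN 1 c c0 ler01).
Qed.

(** Real part of the integral 1/(c - iy) of e^(-(c - iy) w); [F] below is the real part of the
    complex antiderivative. *)
Lemma poisson_kernel_cos c y : 0 < c ->
  Rintegral leb setT (fun w => abel_weight c w * cos (w * y)) = poisson_kernel c y.
Proof.
move=> c0; rewrite Rintegral_abel_weight.
have d0 : 0 < c ^+ 2 + y ^+ 2 by rewrite ltr_wpDr ?sqr_ge0// exprn_gt0.
have cosy : continuous (fun w : R => cos (w * y)).
  move=> w; apply: (@continuous_comp _ _ _ (fun w => w * y) cos).
    by apply: cvgM; [exact: cvg_id|exact: cvg_cst].
  exact: continuous_cos.
have siny : continuous (fun w : R => sin (w * y)).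
  move=> w; apply: (@continuous_comp _ _ _ (fun w => w * y) sin).
    by apply: cvgM; [exact: cvg_id|exact: cvg_cst].
  exact: continuous_sin.
pose F w : R := expR (- (c * w)) *
  ((y * sin (w * y) - c * cos (w * y)) / (c ^+ 2 + y ^+ 2)).
transitivity (0 - F 0); last first.
  rewrite /F !mul0r mulr0 oppr0 expR0 sin0 cos0 /poisson_kernel.
  by rewrite mul1r mulr0 mulr1 sub0r sub0r mulNr opprK.
have cF : continuous F.
  move=> w; apply: cvgM; first exact: continuous_expRN.
  apply: cvgM; last exact: cvg_cst.
  by apply: cvgB; apply: cvgM; [exact: cvg_cst|exact: siny|exact: cvg_cst|exact: cosy].
apply: (@expRN_dominated_FTC2y _ _ F 1 c 0) => //.
- move=> w w0; rewrite normrM mul1r ger0_norm ?expR_ge0// ler_piMr ?expR_ge0//.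
  exact: cos_max.
- apply: continuous_subspaceT => w; apply: cvgM; first exact: continuous_expRN.
  exact: cosy.
- pose K := (`|y| + c) / (c ^+ 2 + y ^+ 2).
  have lim0 s : s * expR (- (c * w)) @[w --> +oo] --> (0 : R).
    by rewrite -[X in _ --> X](mulr0 s); apply: cvgM; [exact: cvg_cst|exact: cvgy_expRN].
  apply: (@squeeze_cvgr _ _ _ _ (fun w => - K * expR (- (c * w)))
    (fun w => K * expR (- (c * w)))) => //.
  near=> w; rewrite mulNr -ler_norml /F mulrC normrM (ger0_norm (expR_ge0 _)).
  rewrite ler_wpM2r ?expR_ge0// normrM (ger0_norm (_ : 0 <= _^-1)) ?invr_ge0 ?(ltW d0)//.
  rewrite /K ler_wpM2r ?invr_ge0 ?(ltW d0)// (le_trans (ler_normB _ _))//.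
  rewrite !normrM (ger0_norm (ltW c0)) lerD//.
    by rewrite ler_piMr// sin_max.
  by rewrite ler_piMr ?cos_max// ltW.
- move=> w w0; apply: is_derive_eq; rewrite /GRing.scale/=.
  by field; rewrite gt_eqF.
- by apply: cvg_at_right_filter; exact: cF.
Unshelve. all: by end_near. Qed.

End PoissonKernel.

(** * Integrable functions with nonnegative Fourier transform *)

Section PositiveDefinite.
Context {R : realType}.
Local Notation leb := (@lebesgue_measure R).
Variables (F E : R -> R).
Hypotheses (intF : leb.-integrable setT (EFin \o F)).
Hypotheses (Fcos : forall w, Rintegral leb setT (fun y => F y * cos (w * y)) = E w).
Hypotheses (Fsin : forall w, Rintegral leb setT (fun y => F y * sin (w * y)) = 0).
Hypotheses (E_ge0 : forall w, 0 <= E w).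

Let integrable_trig (g : R -> R) w : continuous g -> (forall x, `|g x| <= 1) ->
  leb.-integrable setT (EFin \o (fun y => F y * g (w * y))).
Proof.
move=> cg g1; apply: (@integrable_mul_bounded _ _ (fun y => g (w * y)) 1) => //.
apply: continuous_measurable_fun => y.
apply: (@continuous_comp _ _ _ (fun y => w * y) g); last exact: cg.
by apply: cvgM; [exact: cvg_cst|exact: cvg_id].
Qed.

Let fourier_shift x w :
  Rintegral leb setT (fun y => F y * cos (w * (x - y))) = cos (w * x) * E w.
Proof.
have icos : leb.-integrable setT (EFin \o (fun y => F y * cos (w * y))).
  by apply: integrable_trig; [exact: continuous_cos|exact: cos_max].
have isin : leb.-integrable setT (EFin \o (fun y => F y * sin (w * y))).
  by apply: integrable_trig; [exact: continuous_sin|exact: sin_max].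
transitivity (Rintegral leb setT (fun y =>
    cos (w * x) * (F y * cos (w * y)) + sin (w * x) * (F y * sin (w * y)))).
  by apply: eq_Rintegral => y _; rewrite mulrBr cosB; ring.
rewrite RintegralD//; last 2 first.
- by have := integrableZl measurableT (cos (w * x)) icos; exact.
- by have := integrableZl measurableT (sin (w * x)) isin; exact.
by rewrite !RintegralZl// Fcos Fsin mulr0 addr0.
Qed.

(** Abel-summed Fourier inversion: after [Fubini_mul_bounded], one inner integral is [fourier_shift]
    and the other is [poisson_kernel_cos]. *)
Let poisson_average x c : 0 < c ->
  leb.-integrable setT (EFin \o (fun w => abel_weight c w * (cos (w * x) * E w))) /\
  Rintegral leb setT (fun w => abel_weight c w * (cos (w * x) * E w)) =
  Rintegral leb setT (fun y => F y * poisson_kernel c (x - y)).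
Proof.
move=> c0.
have mk : measurable_fun setT (fun z : R * R => cos (z.1 * (x - z.2))).
  apply: measurableT_comp; first by apply: continuous_measurable_fun; exact: continuous_cos.
  apply: measurable_funM; first exact: measurable_fst.
  by apply: measurable_funB; [exact: measurable_cst|exact: measurable_snd].
have [] := Fubini_mul_bounded _ _ _ (integrable_abel_weight _ c0) intF mk
  (fun z => cos_max _).
have -> : (fun w => Rintegral leb setT (fun y => abel_weight c w * F y * cos (w * (x - y))))
    = (fun w => abel_weight c w * (cos (w * x) * E w)).
  apply/funext => w; rewrite -fourier_shift -RintegralZl//.
    by apply: eq_Rintegral => y _; rewrite mulrA.
  apply: (@integrable_mul_bounded _ _ (fun y => cos (w * (x - y))) 1) => //.
    exact: (measurable_fun_pair2 w mk).
  by move=> y; exact: cos_max.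
move=> ? ->; split => //; apply: eq_Rintegral => y _.
rewrite -poisson_kernel_cos// -RintegralZl//.
  by apply: eq_Rintegral => w _; rewrite mulrCA mulrA.
apply: (@integrable_mul_bounded _ _ (fun w => cos (w * (x - y))) 1) => //.
- exact: integrable_abel_weight.
- exact: (measurable_fun_pair1 y mk).
- by move=> w; exact: cos_max.
Qed.

(** On the Fourier side the averages at x and at 0 differ only by the factor cos(w x), of modulus at
    most 1, in front of a nonnegative integrand. *)
Lemma poisson_average_le x c : 0 < c ->
  `|Rintegral leb setT (fun y => F y * poisson_kernel c (x - y))| <=
  Rintegral leb setT (fun y => F y * poisson_kernel c (- y)).
Proof.
move=> c0; have [ix <-] := poisson_average x _ c0.
have [i0 e0] := poisson_average 0 _ c0.
under [leRHS]eq_Rintegral do rewrite -sub0r.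
rewrite -e0; apply: (le_trans (le_normr_Rintegral _ ix)) => //.
apply: le_Rintegral => //; first exact: integrable_norm.
move=> w _ /=; rewrite mulr0 cos0 mul1r (normrM (abel_weight c w)).
rewrite (normrM (cos _)) (ger0_norm (abel_weight_ge0 _ _)).
by rewrite (ger0_norm (E_ge0 w)) ler_wpM2l ?abel_weight_ge0// ler_piMl ?cos_max.
Qed.

Lemma positive_definite_bounded : continuous F -> exists B, forall x, `|F x| <= B.
Proof.
move=> cF.
have cnF : continuous (fun x => `|F x|).
  by move=> x; apply: cvg_norm; exact: cF.
have [m _ Fm] : exists2 m, m \in `[(-1 : R), 1] &
    forall t, t \in `[(-1 : R), 1] -> `|F t| <= `|F m|.
  by apply: EVT_max; [lra|exact: continuous_subspaceT].
have intnF : leb.-integrable setT (EFin \o (fun y => `|F y|)).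
  exact: integrable_norm.
pose L := Rintegral leb setT (fun y => `|F y|).
have L0 : 0 <= L by exact: Rintegral_ge0.
(* The Poisson average at 0 is bounded uniformly in c, using F bounded on
   [-1, 1] and in L1; at x and for small c, it is at least |F x| - 2. *)
exists (`|F m| * pi + L + 2) => x.
have [F1|F1] := leP `|F x| 1.
  have : 0 <= `|F m| * pi by rewrite mulr_ge0// pi_ge0.
  lra.
have [d d0 Fd] : exists2 d, 0 < d & forall y, `|x - y| <= d -> `|F x - F y| <= 1.
  have /cvgrPdist_le/(_ 1 ltr01) := cF x.
  move=> /nbhs_ballP[e /= e0 be]; exists (e / 2); first by rewrite divr_gt0.
  move=> y xy; apply: be; rewrite /ball/= (le_lt_trans xy)//.
  by rewrite ltr_pdivrMr// ltr_pMr// ltr1n.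
(* c <= 1 makes the kernel at most 1 outside [-1, 1]; c <= d keeps [x - c, x + c] where F is within
   1 of F x; c (L + 1) <= d^2 makes the far part cost at most 1. *)
pose c := Num.min 1 (Num.min d (d ^+ 2 / (L + 1))).
have c0 : 0 < c by rewrite !lt_min ltr01 d0 divr_gt0 ?exprn_gt0// ltr_wpDl.
have c1 : c <= 1 by rewrite ge_min lexx.
have cd : c <= d by rewrite !ge_min lexx/= orbT.
have cL : c * (L + 1) <= d ^+ 2.
  by rewrite -ler_pdivlMr ?ltr_wpDl// !ge_min lexx !orbT.
have K0 y : 0 <= poisson_kernel c y by exact/poisson_kernel_ge0/ltW.
have iFK z s : leb.-integrable setT (EFin \o (fun y => F y * poisson_kernel c (z + s * y))).
  apply: (@integrable_mul_bounded _ _ (fun y => poisson_kernel c (z + s * y)) c^-1) => //.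
    apply: (@measurableT_comp _ _ _ _ _ _ (poisson_kernel c) _ (fun y => z + s * y)).
      exact: measurable_poisson_kernel.
    by apply: measurable_funD => //; exact: measurable_funM.
  by move=> y; rewrite ger0_norm// poisson_kernel_le.
have iK a b : leb.-integrable setT
    (EFin \o (fun y => \1_(`[a, b]%classic : set R) y * poisson_kernel c y)).
  apply: (@integrable_mul_bounded _ _ (poisson_kernel c) c^-1) => //.
  - exact: integrable_indic_itv.
  - exact: measurable_poisson_kernel.
  - by move=> y; rewrite ger0_norm// poisson_kernel_le.
(* On [-1, 1], |F| <= |F m| and the kernel has mass at most pi; elsewhere the kernel is at most 1
   and the L1 norm suffices. *)
have upper : Rintegral leb setT (fun y => F y * poisson_kernel c (- y)) <=
    `|F m| * pi + L.
  pose k y := \1_(`[(-1), 1]%classic : set R) y * poisson_kernel c y.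
  have ik : leb.-integrable setT (EFin \o (fun y => `|F m| * k y)).
    by have := integrableZl measurableT `|F m| (iK (-1) 1); exact.
  apply: (@le_trans _ _ (Rintegral leb setT (fun y => `|F m| * k y + `|F y|))).
    apply: le_Rintegral => //.
    - have := iFK 0 (-1); congr (is_true (integrable _ _ _)).
      by apply/funext => y /=; rewrite add0r mulN1r.
    - by have := integrableD measurableT ik intnF; exact.
    move=> y _; have -> : poisson_kernel c (- y) = poisson_kernel c y.
      by rewrite /poisson_kernel sqrrN.
    apply: (@le_trans _ _ (`|F y| * poisson_kernel c y)).
      by rewrite ler_wpM2r// ler_norm.
    rewrite /k indicE mem_setE; have [y1|y1] := boolP (y \in `[(-1), 1]).
      by rewrite mul1r ler_wpDr// ler_wpM2r// Fm.
    rewrite mul0r mulr0 add0r ler_piMr// /poisson_kernel ler_pdivrMr; last first.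
      by rewrite ltr_wpDr ?sqr_ge0// exprn_gt0.
    rewrite mul1r (le_trans c1)// ler_wpDl ?sqr_ge0// leNgt -real_normK ?num_real//.
    apply/negP; rewrite expr_lt1// ltr_norml => /andP[yl yr].
    by move: y1; rewrite in_itv/= !ltW.
  rewrite RintegralD// RintegralZl//; last exact: iK.
  rewrite lerD2r ler_wpM2l//.
  have -> : Rintegral leb setT k = Rintegral leb `[(-1), 1] (poisson_kernel c).
    rewrite [RHS]Rintegral_mkcond; apply: eq_Rintegral => y _.
    by rewrite /k patchE indicE; case: ifP => _; rewrite ?mul1r ?mul0r.
  by apply: Rintegral_poisson_kernel_le => //; rewrite gtrN.
have lower : `|F x| - 2 <= `|Rintegral leb setT (fun y => F y * poisson_kernel c (x - y))|.
  pose s := Num.sg (F x).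
  have ci : c / d ^+ 2 * L <= 1.
    rewrite mulrAC ler_pdivrMr ?exprn_gt0// mul1r (le_trans _ cL)//.
    by rewrite ler_pM2l// lerDl.
  have xK : leb.-integrable setT (EFin \o (fun y => F y * poisson_kernel c (x - y))).
    have := iFK x (-1); congr (is_true (integrable _ _ _)).
    by apply/funext => y /=; rewrite mulN1r.
  apply: (@le_trans _ _ (s * Rintegral leb setT (fun y => F y * poisson_kernel c (x - y)))); last first.
    rewrite (le_trans (ler_norm _))// normrM normr_sg.
    by case: (_ != 0); rewrite ?mul1r ?mul0r.
  rewrite -RintegralZl//.
  (* Within distance c of x the kernel is at least 1/(2c) and s F >= |F x| - 1, so [a] bounds the
     integrand below; the interval of length 2c contributes |F x| - 1. Between c and d the integrand
     is nonnegative, and beyond d the kernel is at most c/d^2. *)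
  pose a := (`|F x| - 1) / (2 * c).
  have a0 : 0 <= a by rewrite divr_ge0 ?mulr_ge0 ?(ltW c0)// subr_ge0 ltW.
  pose ind y : R := \1_(`[x - c, x + c]%classic : set R) y.
  have iind : leb.-integrable setT (EFin \o (fun y => a * ind y)).
    by have := integrableZl measurableT a (integrable_indic_itv (x - c) (x + c) true false); exact.
  have inF : leb.-integrable setT (EFin \o (fun y => c / d ^+ 2 * `|F y|)).
    by have := integrableZl measurableT (c / d ^+ 2) intnF; exact.
  apply: (@le_trans _ _ (Rintegral leb setT (fun y => a * ind y - c / d ^+ 2 * `|F y|))).
    rewrite RintegralB// !RintegralZl//; last exact: integrable_indic_itv.
    have -> : Rintegral leb setT ind = 2 * c.
      rewrite /Rintegral integral_indic// setIT.
      transitivity (fine ((2 * c)%:E)) => //; congr fine.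
      apply: (etrans (lebesgue_measure_itv _)) => /=.
      rewrite lte_fin ltrD2l gtrN// -EFinB; congr EFin; ring.
    rewrite -/L /a divfK; last by rewrite gt_eqF// mulr_gt0.
    have -> : `|F x| - 2 = `|F x| - 1 - 1 by ring.
    by rewrite lerD2l lerN2.
  apply: le_Rintegral => //.
  - by have := integrableB measurableT iind inF; exact.
  - by have := integrableZl measurableT s xK; exact.
  move=> y _ /=.
  have sF : `|F x| - `|F x - F y| <= s * F y.
    have -> : s * F y = `|F x| - s * (F x - F y).
      by rewrite mulrBr -normrEsg; ring.
    rewrite lerD2l lerN2 (le_trans (ler_norm _))// normrM normr_sg.
    by case: (_ != 0); rewrite ?mul1r ?mul0r.
  rewrite mulrA /ind indicE mem_setE; have [yc|yc] := boolP (y \in `[x - c, x + c]).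
    have xyc : `|x - y| <= c.
      by move: yc; rewrite in_itv/= ler_norml => /andP[]; lra.
    have := Fd y (le_trans xyc cd) => Fxy.
    rewrite mulr1 (@le_trans _ _ a)//.
      by rewrite gerBl// mulr_ge0// divr_ge0// ?exprn_ge0// ltW.
    rewrite /a; apply: ler_pM => //.
    - by rewrite subr_ge0 ltW.
    - by rewrite invr_ge0 mulr_ge0// ltW.
    - by rewrite (le_trans _ sF)// lerD2l lerN2.
    rewrite /poisson_kernel.
    have -> : (2 * c)^-1 = c / (2 * c ^+ 2) by field; rewrite gt_eqF.
    rewrite ler_pM2l// lef_pV2 ?posrE ?mulr_gt0 ?exprn_gt0//; last first.
      by rewrite ltr_wpDr ?sqr_ge0// exprn_gt0.
    have : (x - y) ^+ 2 <= c ^+ 2.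
      by rewrite -real_normK ?num_real// lerXn2r ?nnegrE// ltW.
    lra.
  rewrite mulr0 sub0r; have [xyd|xyd] := leP `|x - y| d.
    have := Fd y xyd => Fxy.
    apply: (@le_trans _ _ 0).
      by rewrite oppr_le0 mulr_ge0// divr_ge0// ?exprn_ge0// ltW.
    rewrite mulr_ge0// (le_trans _ sF)// subr_ge0 (le_trans Fxy)// ltW//.
  rewrite lerNl -mulNr (@le_trans _ _ (`|F y| * poisson_kernel c (x - y)))//.
    rewrite ler_wpM2r// (le_trans (ler_norm _))// normrN normrM normr_sg.
    by case: (_ != 0); rewrite ?mul1r ?mul0r.
  rewrite mulrC ler_wpM2r// /poisson_kernel ler_pM2l// lef_pV2 ?posrE ?exprn_gt0//.
    rewrite -[(x - y) ^+ 2]real_normK ?num_real// ler_wpDl ?sqr_ge0//.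
    by rewrite lerXn2r ?nnegrE// ltW.
  by rewrite ltr_wpDr ?sqr_ge0// exprn_gt0.
rewrite -lerBlDr; apply: (le_trans lower); apply: le_trans upper.
exact: poisson_average_le.
Qed.

End PositiveDefinite.

(** * Uniform convergence *)

Section BallNorm.
Context {R : realType}.
Local Notation leb := (@lebesgue_measure R).
Implicit Types (p : \bar R) (r eta : R).

(** The integral of a nonnegative function is a supremum over the simple functions below it, hence
    monotone for arbitrary functions, as [LpB_le] requires. *)
Lemma ge0_le_integralT (f g : R -> \bar R) : (forall x, 0 <= f x)%E ->
  (forall x, f x <= g x)%E -> (\int[leb]_x f x <= \int[leb]_x g x)%E.
Proof.
move=> f0 fg; rewrite !ge0_integralTE//; last by move=> x; exact: le_trans (fg x).
by apply: ereal_sup_le => _ [h hf <-]; exists h => // x; exact: le_trans (fg x).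
Qed.

(** The value 0 at +oo lets finite and infinite exponents share one power bound. *)
Definition invp p : R := if p is r%:E then r^-1 else 0.

Lemma invp_itv p : (1 <= p)%E -> 0 <= invp p <= 1.
Proof.
case: p => [q| |]//=; rewrite ?lexx ?ler01// lee_fin => q1.
by rewrite invr_ge0 (le_trans ler01 q1)/= invf_le1// (lt_le_trans ltr01).
Qed.

Lemma pow_minus_invpE p r : (1 <= p)%E -> pow_minus_invp p r = r `^ (- invp p).
Proof. by case: p => //= _; rewrite oppr0 powRr0. Qed.

Lemma LpB_ge0 p r f : (0 <= LpB p r f)%E.
Proof. exact: Lnorm_ge0. Qed.

(** Comparison with eta times the indicator of an interval of length 2r; for p = +oo the length
    factor is a zeroth power. *)
Lemma LpB_le p r eta (f : R -> R) : (1 <= p)%E -> 0 < r -> 0 <= eta ->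
  (forall x, `|x| < r -> `|f x| <= eta) ->
  (LpB p r f <= (eta * (2 * r) `^ invp p)%:E)%E.
Proof.
move=> p1 r0 eta0 fr.
have bnd x : `|\1_(`]- r, r[%classic : set R) x * f x| <=
    eta * \1_(`]- r, r[%classic : set R) x.
  rewrite indicE mem_setE; have [xr|xr] := boolP (x \in `]- r, r[).
    by rewrite mul1r mulr1 fr// ltr_norml; move: xr; rewrite in_itv.
  by rewrite mul0r mulr0 normr0.
rewrite /LpB unlock; case: p p1 => [q q1| _|]//=; last first.
  rewrite powRr0 mulr1; case: ifP => _; last by rewrite lee_fin.
  apply/ess_supP; apply: nearW => x /=; rewrite lee_fin (le_trans (bnd x))//.
  by rewrite ler_piMr// indicE; case: (_ \in _).
have q0 : 0 < q by rewrite -lte_fin (lt_le_trans _ q1)// lte_fin.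
have -> : (eta * (2 * r) `^ q^-1)%:E = ((eta `^ q * (2 * r))%:E `^ q^-1)%E.
  have r2 : 0 <= 2 * r by rewrite mulr_ge0// ltW.
  rewrite poweR_EFin (powRM _ (powR_ge0 eta q) r2).
  by rewrite -powRrM mulfV ?gt_eqF// powRr1.
apply: gt0_ler_poweR.
- by rewrite invr_ge0 ltW.
- by rewrite in_itv/= leey andbT integral_ge0// => x _; exact: poweR_ge0.
- rewrite in_itv/= leey andbT lee_fin.
  by rewrite mulr_ge0 ?powR_ge0// mulr_ge0// ltW.
have -> : (eta `^ q * (2 * r))%:E =
    (\int[leb]_x ((eta `^ q)%:E * (\1_(`]- r, r[%classic : set R) x)%:E))%E.
  rewrite ge0_integralZl//.
  - rewrite integral_indic// setIT EFinM; congr (_ * _)%E; apply/esym.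
    apply: (etrans (lebesgue_measure_itv _)) => /=.
    by rewrite lte_fin gtrN// -EFinB opprK mulr_natl.
  - exact/measurable_EFinP/measurable_indic.
  - by rewrite lee_fin powR_ge0.
apply: ge0_le_integralT => x; first by rewrite lee_fin powR_ge0.
rewrite -EFinM lee_fin; have := bnd x.
rewrite indicE; case: (x \in _) => /=; rewrite ?mulr1 ?mulr0 ?mul1r ?mul0r => h.
  by rewrite ge0_ler_powR ?nnegrE// ltW.
by rewrite normr0 powR0// gt_eqF.
Qed.

Lemma cvge0_le (f : R -> \bar R) : (forall t, (0 <= f t)%E) ->
  (forall e : R, 0 < e -> \forall t \near +oo, (f t <= e%:E)%E) ->
  f t @[t --> +oo] --> 0%E.
Proof.
move=> f0 fe; apply/fine_cvgP; split.
  near=> t; rewrite ge0_fin_numE//.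
  by apply: (@le_lt_trans _ _ 1%:E); [near: t; exact: fe|exact: ltry].
apply/cvgrPdist_le => e e0; near=> t.
have : (f t <= e%:E)%E by near: t; exact: fe.
rewrite sub0r normrN /=; have := f0 t; case: (f t) => [s| |]//=.
by rewrite !lee_fin => s0; rewrite ger0_norm.
Unshelve. all: by end_near. Qed.

End BallNorm.

(** * Averages of a dilated continuous bounded function *)

Section UniformLimit.
Context {R : realType}.
Local Notation leb := (@lebesgue_measure R).
Implicit Types (u F : R -> R).

Definition outer (n : nat) : set R := ~` `[- n%:R, n%:R]%classic.

(** Dominated convergence with majorant |u|: at each y the indicator vanishes once n >= |y|. *)
Lemma integral_tail_cvg0 u : leb.-integrable setT (EFin \o u) ->
  Rintegral leb setT (fun y => u y * \1_(outer n) y) @[n --> \oo] --> 0.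
Proof.
move=> iu; have /integrableP[/measurable_EFinP mu _] := iu.
have mt n : measurable (outer n) by apply: measurableC; exact: measurable_itv.
have mut n : measurable_fun setT (fun y : R => u y * \1_(outer n) y).
  by apply: measurable_funM => //; exact: measurable_indic.
have [] := @dominated_convergence _ _ _ leb setT measurableT
  (fun n y => (u y * \1_(outer n) y)%:E) (cst 0%E) (fun y => `|u y|%:E).
- by move=> n; apply/measurable_EFinP; exact: mut.
- exact: measurable_cst.
- apply: aeW => y _; apply: cvg_near_cst; near=> n.
  have yn : `|y| <= n%:R.
    by near: n; exact: nbhs_infty_ger.
  rewrite indicE memNset ?mulr0//= /outer /= in_itv/= -ler_norml yn.
  by move=> /(_ isT).
- exact: integrable_norm.
- apply: aeW => y n _ /=; rewrite lee_fin normrM ler_piMr// indicE.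
  by case: (_ \in _); rewrite ?normr1 ?normr0.
by move=> _ _; rewrite integral0 => /fine_cvg.
Unshelve. all: by end_near. Qed.

Lemma dilated_average_cvg u F (B : R) (c r : R -> R) :
  leb.-integrable setT (EFin \o u) -> (forall y, 0 <= u y) ->
  continuous F -> (forall x, `|F x| <= B) ->
  (forall t : R, 0 < t -> 0 < c t) -> c t @[t --> +oo] --> 0 ->
  r t * c t @[t --> +oo] --> 0 ->
  forall eta : R, 0 < eta -> \forall t \near +oo, forall x : R, `|x| < r t ->
    `|Rintegral leb setT (fun y => F ((x - y) * c t) * u y) -
      Rintegral leb setT u * F 0| <= eta.
Proof.
move=> iu u0 cF FB c0 cc rc eta eta0.
have B0 : 0 <= B := le_trans (normr_ge0 _) (FB 0).
pose M := Rintegral leb setT u.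
have M0 : 0 <= M by exact: Rintegral_ge0.
(* [e1] bounds the oscillation of F near 0 and [e2] the mass of u in the tail, so that e1 M and 2 B
   e2 are each at most eta/2; the added 1 keeps denominators positive. *)
pose e1 := eta / (2 * (M + 1)).
have M1 : 0 < 2 * (M + 1) by rewrite mulr_gt0// ltr_wpDl.
have e10 : 0 < e1 by rewrite divr_gt0.
pose e2 := eta / (2 * (2 * B + 1)).
have B1 : 0 < 2 * (2 * B + 1) by rewrite mulr_gt0// ltr_wpDl// mulr_ge0.
have e20 : 0 < e2 by rewrite divr_gt0.
have [n tn] : exists n, Rintegral leb setT (fun y => u y * \1_(outer n) y) <= e2.
  have /cvgrPdist_le/(_ _ e20)[n _ /(_ n (leqnn n))] := integral_tail_cvg0 _ iu.
  by rewrite sub0r normrN => h; exists n; exact: le_trans (ler_norm _) h.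
have [d d0 Fd] : exists2 d, 0 < d & forall z, `|z| < d -> `|F z - F 0| <= e1.
  have /cvgrPdist_le/(_ _ e10)/nbhs_ballP[d d0 bd] := cF 0.
  exists d => // z zd; rewrite distrC; apply: bd.
  by rewrite /ball/= sub0r normrN.
have mt : measurable (outer n) by apply: measurableC; exact: measurable_itv.
have /integrableP[/measurable_EFinP mu _] := iu.
have it : leb.-integrable setT (EFin \o (fun y => u y * \1_(outer n) y)).
  apply: (@integrable_mul_bounded _ _ (\1_(outer n)) 1) => //.
  by move=> y; rewrite indicE; case: (_ \in _); rewrite ?normr1 ?normr0.
(* For |x| < r t and |y| <= n the argument (x - y) c t is at most (r t + n) c t in modulus; this
   gives uniformity in x. *)
have rnc : (r t + n%:R) * c t @[t --> +oo] --> 0.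
  have -> : (fun t => (r t + n%:R) * c t) = (fun t => r t * c t + n%:R * c t).
    by apply/funext => t; rewrite mulrDl.
  rewrite -(addr0 0); apply: cvgD => //.
  by rewrite -(mulr0 n%:R); apply: cvgM => //; exact: cvg_cst.
near=> t => x xr.
have t0 : 0 < t by near: t; exact: nbhs_pinfty_gt.
have ct0 := c0 t t0.
have small : (r t + n%:R) * c t < d.
  rewrite (le_lt_trans (ler_norm _))// -normrN -sub0r.
  by near: t; move/cvgrPdist_lt : rnc; exact.
pose G (y : R) := F ((x - y) * c t) - F 0.
have mG : measurable_fun setT (fun y : R => F ((x - y) * c t)).
  apply: continuous_measurable_fun => y.
  apply: (@continuous_comp _ _ _ (fun y : R => (x - y) * c t) F); last exact: cF.
  apply: cvgM; last exact: cvg_cst.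
  by apply: cvgB; [exact: cvg_cst|exact: cvg_id].
have iF : leb.-integrable setT (EFin \o (fun y : R => u y * F ((x - y) * c t))).
  by apply: (integrable_mul_bounded _ _ B).
have iF0 : leb.-integrable setT (EFin \o (fun y => u y * F 0)).
  by apply: (@integrable_mul_bounded _ u (cst (F 0)) B) => // y; exact: FB.
have GB (y : R) : `|G y| <= 2 * B.
  by rewrite (le_trans (ler_normB _ _))// mulr_natl mulr2n lerD.
have iG : leb.-integrable setT (EFin \o (fun y => u y * G y)).
  by apply: (@integrable_mul_bounded _ u G (2 * B)) => //; apply: measurable_funB.
have -> : Rintegral leb setT (fun y => F ((x - y) * c t) * u y) - M * F 0 =
    Rintegral leb setT (fun y => u y * G y).
  rewrite -RintegralZr// -RintegralB//; last first.
    by have -> : (fun y => F ((x - y) * c t) * u y) =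
      (fun y => u y * F ((x - y) * c t)) by apply/funext => y; rewrite mulrC.
  by apply: eq_Rintegral => y _; rewrite mulrBr mulrC.
apply: (le_trans (le_normr_Rintegral _ iG)) => //.
have i1 : leb.-integrable setT (EFin \o (fun y => e1 * u y)).
  by have := integrableZl measurableT e1 iu; exact.
have i2 : leb.-integrable setT (EFin \o (fun y => 2 * B * (u y * \1_(outer n) y))).
  by have := integrableZl measurableT (2 * B) it; exact.
apply: (@le_trans _ _ (Rintegral leb setT
    (fun y => e1 * u y + 2 * B * (u y * \1_(outer n) y)))).
  apply: le_Rintegral => //.
  - exact: integrable_norm.
  - by have := integrableD measurableT i1 i2; exact.
  move=> y _ /=; rewrite normrM (ger0_norm (u0 y)) indicE.
  have [yn|yn] := boolP (y \in outer n).
    rewrite mulr1; apply: ler_wpDl; first by rewrite mulr_ge0// ltW.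
    by rewrite mulrC ler_wpM2r.
  rewrite mulr0 mulr0 addr0 mulrC ler_wpM2r// Fd// normrM (gtr0_norm ct0).
  apply: le_lt_trans small; rewrite ler_pM2r// (le_trans (ler_normB _ _))//.
  apply: lerD; first exact: ltW.
  by move: yn; rewrite /outer in_setC negbK mem_setE in_itv/= -ler_norml.
rewrite RintegralD// !RintegralZl//.
have h1 : e1 * M <= eta / 2.
  rewrite /e1 mulrAC ler_pdivrMr//.
  have -> : eta / 2 * (2 * (M + 1)) = eta * (M + 1) by field.
  by rewrite ler_pM2l// lerDl.
have h2 : 2 * B * e2 <= eta / 2.
  rewrite /e2 mulrCA ler_pM2l// ler_pdivrMr//.
  have -> : 2^-1 * (2 * (2 * B + 1)) = 2 * B + 1 :> R by field.
  by rewrite lerDl.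
rewrite [leRHS](splitr eta) lerD// (le_trans _ h2)// ler_wpM2l// mulr_ge0//.
Unshelve. all: by end_near. Qed.

End UniformLimit.

(** * Decay of negative powers and the limits for the mild solution *)

Lemma powRN_cvg0 (R : realType) (a : R) : 0 < a -> t `^ (- a) @[t --> +oo] --> (0 : R).
Proof.
move=> a0; apply: (@cvg_trans _ (expR (- (a * ln t)) @[t --> +oo])).
  apply: near_eq_cvg; near=> t.
  have t0 : 0 < t by near: t; exact: nbhs_pinfty_gt.
  by rewrite /powR (gt_eqF t0) mulNr.
apply: (@cvg_comp _ _ _ (@ln R) (fun x => expR (- (a * x))) _ +oo%R); last exact: cvgy_expRN.
apply/cvgryPge => A; near=> t.
have t0 : 0 < t by near: t; exact: nbhs_pinfty_gt.
rewrite -[A]expRK ler_ln ?posrE ?expR_gt0//.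
Unshelve. all: by end_near. Qed.

Theorem theorem5p7 (R : realType) (alpha : R) (F : R -> R) (u0 : R -> R)
  (p : \bar R) :
  0 < alpha < 1 ->
  is_profile alpha F ->
  (@lebesgue_measure R).-integrable setT (EFin \o u0) ->
  (forall x, 0 <= u0 x) ->
  ~ ({ae (@lebesgue_measure R), forall x, u0 x = 0}) ->
  (1 <= p)%E ->
  let M := Rintegral (@lebesgue_measure R) setT u0 in
  (forall mu : R, 0 < mu ->
     LpB p mu (fun x => t `^ (alpha / 2) * mild_sol alpha F u0 x t - M * F 0)
       @[t --> +oo] --> 0%E)
  /\
  (forall g : R -> R,
     (forall t, 0 < t -> 0 < g t) ->
     g t @[t --> +oo] --> +oo ->
     g t / t `^ (alpha / 2) @[t --> +oo] --> 0 ->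
     ((pow_minus_invp p (g t))%:E *
       LpB p (g t) (fun x => (t `^ (alpha / 2) * mild_sol alpha F u0 x t - M * F 0)%R))%E
       @[t --> +oo] --> 0%E).
Proof.
move=> alpha01 [intF cF Fcos Fsin] iu u_ge0 _ p1 M.
have [B FB] := @positive_definite_bounded R F _ intF Fcos Fsin
  (fun w => mittag_leffler_ge0 _ _ alpha01 (sqr_ge0 w)) cF.
have a0 : 0 < alpha / 2 by rewrite divr_gt0//; case/andP: alpha01.
have B0 : 0 <= B := le_trans (normr_ge0 _) (FB 0).
have scaled x t : 0 < t -> t `^ (alpha / 2) * mild_sol alpha F u0 x t =
    Rintegral (@lebesgue_measure R) setT
      (fun y => F ((x - y) * t `^ (- (alpha / 2))) * u0 y).
  move=> t0.
  have iFu : (@lebesgue_measure R).-integrable setT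
      (EFin \o (fun y => F ((x - y) * t `^ (- (alpha / 2))) * u0 y)).
    have -> : (fun y => F ((x - y) * t `^ (- (alpha / 2))) * u0 y) =
      (fun y => u0 y * F ((x - y) * t `^ (- (alpha / 2)))).
      by apply/funext => y; rewrite mulrC.
    apply: (@integrable_mul_bounded _ u0
      (fun y => F ((x - y) * t `^ (- (alpha / 2)))) B) => //.
    apply: continuous_measurable_fun => y.
    apply: (@continuous_comp _ _ _
      (fun y : R => (x - y) * t `^ (- (alpha / 2))) F); last exact: cF.
    apply: cvgM; last exact: cvg_cst.
    by apply: cvgB; [exact: cvg_cst|exact: cvg_id].
  rewrite /mild_sol /fundZ.
  under eq_Rintegral do rewrite -mulrA.
  by rewrite RintegralZl// mulrA powRN divff ?mul1r// gt_eqF// powR_gt0.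
(* One uniform estimate serves both claims, with r constant for (a) and r = g for (b). *)
have uniform (r : R -> R) : r t / t `^ (alpha / 2) @[t --> +oo] --> 0 ->
    forall eta, 0 < eta -> \forall t \near +oo, forall x, `|x| < r t ->
    `|t `^ (alpha / 2) * mild_sol alpha F u0 x t - M * F 0| <= eta.
  move=> rc eta eta0.
  have := @dilated_average_cvg R u0 F B (fun t => t `^ (- (alpha / 2))) r iu u_ge0 cF FB.
  have c0 (t : R) : 0 < t -> 0 < t `^ (- (alpha / 2)) by exact: powR_gt0.
  have rc' : r t * t `^ (- (alpha / 2)) @[t --> +oo] --> 0.
    by under eq_cvg do rewrite powRN.
  move=> /(_ c0 (powRN_cvg0 _ _ a0) rc' eta eta0) H; near=> t => x xr.
  rewrite scaled; last by near: t; exact: nbhs_pinfty_gt.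
  by move: x xr; near: t.
have /andP[q0 q1] := invp_itv p p1.
split.
- move=> mu mu0; apply: cvge0_le => [t|e e0]; first exact: LpB_ge0.
  have k0 : 0 < (2 * mu) `^ invp p by rewrite powR_gt0// mulr_gt0.
  have mc : mu / t `^ (alpha / 2) @[t --> +oo] --> 0.
    rewrite -(mulr0 mu); apply: cvgM; first exact: cvg_cst.
    by under eq_cvg do rewrite -powRN; exact: powRN_cvg0.
  have H := uniform (fun=> mu) mc _ (divr_gt0 e0 k0).
  (* The tolerance e/(2 mu)^(1/p) cancels the length factor of [LpB_le]. *)
  near=> t; apply: (le_trans (LpB_le p mu (e / (2 * mu) `^ invp p) _ p1 mu0 _ _)).
  + by rewrite ltW// divr_gt0.
  + by near: t.
  + by rewrite divfK// gt_eqF.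
- move=> g g0 _ gc; apply: cvge0_le => [t|e e0].
    by rewrite mule_ge0 ?LpB_ge0// lee_fin pow_minus_invpE// powR_ge0.
  (* e/2 suffices because g^(-1/p) (2g)^(1/p) = 2^(1/p) <= 2. *)
  have H := uniform g gc _ (divr_gt0 e0 (ltr0n R 2)).
  near=> t; have t0 : 0 < t by near: t; exact: nbhs_pinfty_gt.
  have gt0 := g0 t t0.
  have bound : (LpB p (g t) (fun x =>
      (t `^ (alpha / 2) * mild_sol alpha F u0 x t - M * F 0)%R) <=
      (e / 2 * (2 * g t) `^ invp p)%:E)%E.
    apply: LpB_le => //; first by rewrite ltW// divr_gt0.
    by near: t.
  rewrite pow_minus_invpE//.
  apply: (le_trans (lee_wpmul2l _ bound)); first by rewrite lee_fin powR_ge0.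
  rewrite -EFinM lee_fin powRM ?(ltW gt0)//.
  have -> : g t `^ (- invp p) * (e / 2 * (2 `^ invp p * g t `^ invp p)) =
      e / 2 * 2 `^ invp p.
    by rewrite powRN; field; rewrite gt_eqF// powR_gt0.
  rewrite -[leRHS](divfK (x := 2)) ?pnatr_eq0// ler_pM2l ?divr_gt0//.
  by rewrite ler1_powR// ler1n.
Unshelve. all: by end_near. Qed.
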